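(* For any $T,S\in\mathcal{B}_A(\mathcal{H})$, $$w_A(TS+ST)\leq 2\sqrt{2}\,\|T\|_A\,w_A(S).$$
   Context: $(\mathcal{H},\langle\cdot,\cdot\rangle)$ is a complex Hilbert space, $\mathcal{B}(\mathcal{H})$ is the algebra of bounded linear operators on $\mathcal{H}$, and $A\in\mathcal{B}(\mathcal{H})$ is a fixed positive operator ($\langle Ax,x\rangle\ge 0$ for all $x$). Put $\langle x,y\rangle_A=\langle Ax,y\rangle$ and $\|x\|_A=\sqrt{\langle x,x\rangle_A}$ (a seminorm). $\mathcal{B}_A(\mathcal{H})=\{T\in\mathcal{B}(\mathcal{H}): \mathrm{ran}(T^*A)\subseteq \mathrm{ran}(A)\}$, equivalently the set of $T$ for which some $S\in\mathcal{B}(\mathcal{H})$ satisfies $AS=T^*A$ (it is a subalgebra of $\mathcal{B}(\mathcal{H})$). For $T\in\mathcal{B}_A(\mathcal{H})$: the $A$-operator seminorm is $\|T\|_A=\sup\{\|Tx\|_A: x\in\mathcal{H},\ \|x\|_A=1\}$ and the $A$-numerical radius is $w_A(T)=\sup\{|\langle Tx,x\rangle_A|: x\in\mathcal{H},\ \|x\|_A=1\}$. *)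

(* Defs.v *)
From HB Require Import structures.
From mathcomp Require Import all_boot all_order all_algebra.
From mathcomp Require Import all_classical all_reals all_analysis.
From mathcomp Require Import complex.

Set Implicit Arguments.
Unset Strict Implicit.
Unset Printing Implicit Defensive.

Import Order.TTheory GRing.Theory Num.Theory.
Import numFieldNormedType.Exports.

Local Open Scope classical_set_scope.
Local Open Scope ring_scope.
Local Open Scope complex_scope.

(** A complex Hilbert space is a complete normed module [H] over [R[i]] whose
    norm is induced by an inner product [dot], linear in its first argument
    and conjugate-linear in the second. *)
Definition norm_induced_by (R : realType) (H : completeNormedModType R[i])
    (dot : {dot H for @Num.conj R[i]}) : Prop :=
  forall x : H, `|x| ^+ 2 = dot x x.

Section Operators.
Variables (R : realType) (H : completeNormedModType R[i]).
Variable dot : {dot H for @Num.conj R[i]}.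

Definition bounded_operator (T : {linear H -> H}) : Prop :=
  exists M : R, forall x : H, `|T x| <= M%:C * `|x|.

(** On [R[i]], [0 <= z] says that [z] is real and nonnegative. *)
Definition positive_operator (A : {linear H -> H}) : Prop :=
  bounded_operator A /\ forall x : H, 0 <= dot (A x) x.

Definition is_adjoint (T Tstar : {linear H -> H}) : Prop :=
  forall x y : H, dot (T x) y = dot x (Tstar y).

(** The adjoint of a bounded operator on a Hilbert space exists and is unique,
    so the existential below only names [T^*]. *)
Definition in_BA (A T : {linear H -> H}) : Prop :=
  bounded_operator T /\
  exists Tstar : {linear H -> H},
    [/\ bounded_operator Tstar, is_adjoint T Tstar &
        range (Tstar \o A) `<=` range A].

Definition dotA (A : {linear H -> H}) (x y : H) : R[i] := dot (A x) y.

Definition seminormA (A : {linear H -> H}) (x : H) : R :=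
  Num.sqrt (complex.Re (dotA A x x)).

(** [`|z|] lives in [R[i]]; [complex.Re] reads this modulus as a real number.
    The suprema are taken in the extended reals, so that no default value is
    involved when the set is unbounded; they are over the empty set (hence
    [-oo]) exactly when [A = 0]. *)
Definition opnormA (A : {linear H -> H}) (T : H -> H) : \bar R :=
  ereal_sup [set (seminormA A (T x))%:E | x in [set x | seminormA A x = 1]].

Definition numradiusA (A : {linear H -> H}) (T : H -> H) : \bar R :=
  ereal_sup [set (complex.Re `|dotA A (T x) x|)%:E
            | x in [set x | seminormA A x = 1]].

End Operators.

(* Main.v *)
Require Import Defs.
From HB Require Import structures.
From mathcomp Require Import all_boot all_order all_algebra.
From mathcomp Require Import all_classical all_reals all_analysis.
From mathcomp Require Import complex.
From mathcomp Require Import ring lra.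
Set Implicit Arguments.
Unset Strict Implicit.
Unset Printing Implicit Defensive.

Import Order.TTheory GRing.Theory Num.Theory.
Import numFieldNormedType.Exports.
Local Open Scope ring_scope.
Local Open Scope complex_scope.

(** Everything happens in the semi-inner product [<x, y>_A]. Membership in
    [B_A(H)] provides, for each [x], a vector [z] that acts as the value at
    [x] of an adjoint for this form: [<S y, x>_A = <y, z>_A] for
    all [y]. Such a [z] is determined only up to vectors of seminorm zero.

    Write [S# x] and [T# x] for vectors of this kind. For a unit vector [x],
      [<(T S + S T) x, x>_A = <S x, T# x>_A + <T x, S# x>_A],
    and both [T x] and [T# x] have seminorm at most [t = ||T||_A], so that
      [|<(T S + S T) x, x>_A| <= t (||S x||_A + ||S# x||_A)
                              <= t sqrt(2 (||S x||_A^2 + ||S# x||_A^2))].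
    The constant then comes from
      [||S x||_A^2 + ||S# x||_A^2 <= 4 w^2 ||x||_A^2] with [w = w_A(S)]
    ([sqr_seminorm_op_adjoint]). By the parallelogram law the left-hand side
    is half of [||S x + S# x||_A^2 + ||S x - S# x||_A^2], and each of these
    terms is at most [4 w^2 ||x||_A^2], because for the Hermitian operators
    [S + S#] and [i S + (i S)#] the norm equals the numerical radius
    ([real_part_bound]). The last fact is a Cauchy-Schwarz argument: a
    quadratic form dominated by [c ||.||_A^2] has a polar form dominated by
    [c ||x||_A ||y||_A] ([mixed_coef_le]).

    The suprema may be infinite a priori. If one of them is [+oo] and the
    other is positive there is nothing to prove; if one of them is zero, then
    the corresponding operator is null for the seminorm and the left-hand
    side vanishes ([anticommutator_null]). *)

(** * Complex numbers and binary quadratic forms *)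

Lemma ReD (R : rcfType) (x y : R[i]) :
  complex.Re (x + y) = complex.Re x + complex.Re y.
Proof. by case: x y => [a b] [c d]. Qed.

Lemma ReN (R : rcfType) (x : R[i]) : complex.Re (- x) = - complex.Re x.
Proof. by case: x. Qed.

Lemma ReZ (R : rcfType) (r : R) (x : R[i]) :
  complex.Re (r%:C * x) = r * complex.Re x.
Proof. by case: x => a b /=; rewrite mul0r subr0. Qed.

Lemma Re_conj (R : rcfType) (x : R[i]) :
  complex.Re (Num.conj x) = complex.Re x.
Proof. by case: x. Qed.

Lemma conj_real (R : rcfType) (r : R) : Num.conj (r%:C) = r%:C :> R[i].
Proof. exact: conjc_real. Qed.

Lemma Re_normM (R : rcfType) (a b : R[i]) :
  complex.Re `|a * b| = complex.Re `|a| * complex.Re `|b|.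
Proof. by rewrite normrM -[`|a|]RRe_real ?normr_real// ReZ. Qed.

Lemma Re_norm_real (R : rcfType) (r : R) : 0 <= r -> complex.Re `|r%:C| = r.
Proof. by move=> r0; rewrite ger0_norm ?lecR. Qed.

Lemma Re_normD (R : rcfType) (a b : R[i]) :
  complex.Re `|a + b| <= complex.Re `|a| + complex.Re `|b|.
Proof. by rewrite -ReD; have := ler_normD a b; rewrite lecE => /andP[]. Qed.

(** This is the step from diagonal values to off-diagonal ones: [al], [be],
    [ga] are the coefficients of a quadratic form on the plane spanned by two
    vectors, [a], [rho], [d] those of the squared seminorm. Comparing the
    values at [(s, t)] and [(s, - t)] eliminates [rho], and the weights
    [s = sqrt d], [t = sqrt a] are optimal. The same lemma gives
    Cauchy-Schwarz and the bound on the real part of an operator. *)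
Lemma mixed_coef_le (R : rcfType) (al be ga a rho d c : R) :
  0 <= c -> 0 <= a -> 0 <= d ->
  (forall s t : R, `|s ^+ 2 * al + 2 * (s * t * be) + t ^+ 2 * ga| <=
     c * (s ^+ 2 * a + 2 * (s * t * rho) + t ^+ 2 * d)) ->
  be <= c * (Num.sqrt a * Num.sqrt d).
Proof.
move=> c0 a0 d0 h.
have hs (s t : R) : 2 * (s * t * be) <= c * (s ^+ 2 * a + t ^+ 2 * d).
  have := h s t; have := h s (- t); rewrite !ler_norml.
  move=> /andP[h1 _] /andP[_ h2].
  nra.
set p := Num.sqrt a; set q := Num.sqrt d.
have ap : a = p ^+ 2 by rewrite sqr_sqrtr.
have dq : d = q ^+ 2 by rewrite sqr_sqrtr.
have p0 : 0 <= p := sqrtr_ge0 _.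
have q0 : 0 <= q := sqrtr_ge0 _.
rewrite {}ap {}dq in hs.
(* If [p] or [q] vanishes there are no optimal weights: a positive [be] is
   refuted by letting the weight of the null vector grow. *)
have [|] := ltP 0 (p * q).
  by move=> pq0; rewrite -(ler_pM2l pq0); have := hs q p; lra.
move=> pq.
have pq0 : p * q = 0 by apply/eqP; rewrite eq_le pq mulr_ge0.
rewrite pq0 mulr0 leNgt; apply/negP => be0.
move/eqP: pq0; rewrite mulf_eq0 => /orP[] /eqP z.
  have /= := hs ((c * q ^+ 2 + 1) / be) 1; rewrite z expr0n /= mulr0 add0r.
  rewrite mulr1 divfK ?gt_eqF// expr1n mul1r; nra.
have /= := hs 1 ((c * p ^+ 2 + 1) / be); rewrite z expr0n /= mulr0 addr0.
rewrite mul1r divfK ?gt_eqF// expr1n mul1r; nra.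
Qed.

(** * Positive semidefinite Hermitian forms *)

Section SemiInner.
Variables (R : rcfType) (V : lmodType R[i]).
Variable f : {hermitian V for false & @Num.conj R[i]}.
Hypothesis f_ge0 : forall x, 0 <= f x x.

Let re x y : R := complex.Re (f x y).
Let sn x : R := Num.sqrt (complex.Re (f x x)).

Lemma hermitian_conjC x y : f x y = Num.conj (f y x).
Proof. by rewrite hermC /= expr0 mul1r. Qed.
Lemma reC x y : re x y = re y x.
Proof. by rewrite /re hermitian_conjC Re_conj. Qed.
Lemma reDl x y z : re (x + y) z = re x z + re y z.
Proof. by rewrite /re linearDl ReD. Qed.
Lemma reDr x y z : re x (y + z) = re x y + re x z.
Proof. by rewrite reC reDl !(reC x). Qed.
Lemma reNl x y : re (- x) y = - re x y.
Proof. by rewrite /re linearNl ReN. Qed.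
Lemma reNr x y : re x (- y) = - re x y.
Proof. by rewrite reC reNl reC. Qed.
Lemma reZl (r : R) x y : re (r%:C *: x) y = r * re x y.
Proof. by rewrite /re linearZl_LR /= ReZ. Qed.
Lemma reZr (r : R) x y : re x (r%:C *: y) = r * re x y.
Proof. by rewrite reC reZl reC. Qed.
Lemma re_ge0 x : 0 <= re x x.
Proof. by have := f_ge0 x; rewrite lecE => /andP[]. Qed.

Lemma sqr_sn x : sn x ^+ 2 = re x x.
Proof. by rewrite sqr_sqrtr // re_ge0. Qed.

Lemma sn_ge0 x : 0 <= sn x.
Proof. exact: sqrtr_ge0. Qed.

Lemma re_quad s t x y : re (s%:C *: x + t%:C *: y) (s%:C *: x + t%:C *: y) =
  s ^+ 2 * re x x + 2 * (s * t * re x y) + t ^+ 2 * re y y.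
Proof. by rewrite !(reDl, reDr, reZl, reZr) (reC y x); ring. Qed.

Lemma re_cauchy_schwarz x y : re x y <= sn x * sn y.
Proof.
rewrite -[leRHS]mul1r.
apply: (@mixed_coef_le _ (re x x) _ (re y y) _ (re x y)); rewrite ?re_ge0//.
by move=> s t; rewrite -re_quad ger0_norm ?re_ge0// mul1r.
Qed.

Lemma sn_unimodular (u : R[i]) x : `|u| = 1 -> sn (u *: x) = sn x.
Proof.
move=> u1; rewrite /sn linearZl_LR /= linearZr_LR /= mulrA -normCK u1 expr1n.
by rewrite mul1r.
Qed.

(** Multiplying [x] by the phase of [f x y] keeps its seminorm and makes
    [f x y] real, so the inequality for real parts suffices. *)
Lemma cauchy_schwarz x y : complex.Re `|f x y| <= sn x * sn y.
Proof.
have [u u1 ->] : exists2 u : R[i], `|u| = 1 & `|f x y| = u * f x y.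
  have [->|nz] := eqVneq (f x y) 0; first by exists 1;
    rewrite ?normr1 ?normr0 ?mulr0.
  exists (`|f x y| / f x y); last by rewrite divfK.
  by rewrite normf_div normr_id divff ?normr_eq0.
have -> : u * f x y = f (u *: x) y by rewrite linearZl_LR.
by rewrite -(sn_unimodular x u1) re_cauchy_schwarz.
Qed.

Lemma sn_parallelogram x y :
  sn (x + y) ^+ 2 + sn (x - y) ^+ 2 = 2 * (sn x ^+ 2 + sn y ^+ 2).
Proof.
by rewrite !sqr_sn !(reDl, reDr, reNl, reNr) (reC y x); ring.
Qed.

(** The adjoint is a relation between [x] and [z], not an operator: for a
    degenerate form [z] is determined up to a null vector. *)
Definition adjoint_at (S : V -> V) (x z : V) := forall y, f (S y) x = f y z.

(** The operator [S + S#] is Hermitian with diagonal [2 Re (f (S u) u)], at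
    most [2 w ||u||^2] in modulus, so its polar form is at most
    [2 w ||x|| ||y||]; at [y = S x + z] the polar form is [||y||^2]. *)
Lemma real_part_bound (S : {linear V -> V}) (w : R) x z :
  (forall u, complex.Re `|f (S u) u| <= w * re u u) -> 0 <= w ->
  adjoint_at S x z -> sn (S x + z) <= 2 * w * sn x.
Proof.
move=> hw w0 hz.
set y := S x + z.
have hN : re y y = re (S x) y + re (S y) x.
  by rewrite {1}/y reDl (reC z) /re hz.
have : re y y / 2 <= w * (sn x * sn y).
  apply: (@mixed_coef_le _ (re (S x) x) _ (re (S y) y) _ (re x y));
    rewrite ?re_ge0//.
  move=> s t; rewrite -re_quad; apply: le_trans (hw _).
  have -> : S (s%:C *: x + t%:C *: y) = s%:C *: S x + t%:C *: S y.
    by rewrite linearD !linearZ.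
  rewrite hN.
  set u := (X in f X _); set v := (X in f _ X).
  have -> : s ^+ 2 * re (S x) x + 2 * (s * t * ((re (S x) y + re (S y) x) / 2))
     + t ^+ 2 * re (S y) y = re u v.
    by rewrite !(reDl, reDr, reZl, reZr); field.
  by rewrite -lecR RRe_real ?normr_real// normc_ge_Re.
rewrite -sqr_sn; have := sqrtr_ge0 (complex.Re (f y y)); rewrite -/(sn y) => y0.
have x0 : 0 <= sn x := sqrtr_ge0 _.
have [->|ny] := eqVneq (sn y) 0; first by rewrite !mulr_ge0.
have yp : 0 < sn y by rewrite lt_def ny.
by move=> h; rewrite -(ler_pM2l yp); lra.
Qed.

(** Apply [real_part_bound] to [S] and to ['i S], whose adjoint at [x] is
    [- 'i z], and add the two estimates by the parallelogram law. *)
Lemma sqr_seminorm_op_adjoint (S : {linear V -> V}) (w : R) x z :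
  (forall u, complex.Re `|f (S u) u| <= w * re u u) -> 0 <= w ->
  adjoint_at S x z -> sn (S x) ^+ 2 + sn z ^+ 2 <= 4 * w ^+ 2 * sn x ^+ 2.
Proof.
move=> hw w0 hz.
have i1 : `|'i| = 1 :> R[i] by rewrite complexiE normCi.
have h1 := real_part_bound hw w0 hz.
have h2 : sn (S x - z) <= 2 * w * sn x.
  rewrite -(sn_unimodular _ i1) scalerBr.
  apply: (@real_part_bound ('i \*: S)%R w x (- ('i *: z))) => //.
    move=> u; have -> : f (('i \*: S) u) u = 'i * f (S u) u.
      by rewrite /= linearZl_LR.
    by rewrite normrM i1 mul1r.
  move=> y /=; rewrite linearZl_LR /= hz linearNr linearZr_LR /=.
  by rewrite conjCi mulNr opprK.
have x0 : 0 <= sn x := sqrtr_ge0 _.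
have a0 : 0 <= sn (S x + z) := sqrtr_ge0 _.
have b0 : 0 <= sn (S x - z) := sqrtr_ge0 _.
have := sn_parallelogram (S x) z.
have := ler_pM a0 a0 h1 h1; have := ler_pM b0 b0 h2 h2.
rewrite -!expr2; lra.
Qed.

Lemma sn_scale (r : R) x : 0 <= r -> sn (r%:C *: x) = r * sn x.
Proof.
move=> r0; rewrite /sn -/(re (r%:C *: x) (r%:C *: x)) reZl reZr mulrA -expr2.
by rewrite sqrtrM ?sqr_ge0// sqrtr_sqr ger0_norm.
Qed.

Lemma sn_normalize x : sn x != 0 -> sn ((sn x)^-1%:C *: x) = 1.
Proof. by move=> x0; rewrite sn_scale ?invr_ge0 ?sn_ge0// mulVf. Qed.

Definition adjointable (S : V -> V) := forall x, exists z, adjoint_at S x z.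

(** An operator with adjoints passes to the quotient by the null vectors;
    boundedness on unit vectors alone would not give this. *)
Lemma adjointable_null S x : adjointable S -> sn x = 0 -> sn (S x) = 0.
Proof.
move=> /(_ (S x))[z /(_ x) hz] x0; apply/eqP; rewrite -sqrf_eq0 sqr_sn.
rewrite eq_le re_ge0 andbT {1}/re hz -/(re x z).
rewrite (le_trans (re_cauchy_schwarz _ _))//.
by rewrite x0 mul0r.
Qed.

Lemma opnorm_homogeneous (T : {linear V -> V}) (t : R) : adjointable T ->
  (forall u, sn u = 1 -> sn (T u) <= t) -> forall x, sn (T x) <= t * sn x.
Proof.
move=> aT h x; have [x0|x0] := eqVneq (sn x) 0.
  by rewrite adjointable_null// x0 mulr0.
have := h _ (sn_normalize x0); rewrite linearZ /= sn_scale ?invr_ge0 ?sn_ge0//.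
by rewrite mulrC ler_pdivrMr// lt_def x0 sn_ge0.
Qed.

Lemma numradius_homogeneous (S : {linear V -> V}) (w : R) :
  (forall u, sn u = 1 -> complex.Re `|f (S u) u| <= w) ->
  forall x, complex.Re `|f (S x) x| <= w * re x x.
Proof.
move=> h x; rewrite -sqr_sn; have [x0|x0] := eqVneq (sn x) 0.
  by rewrite (le_trans (cauchy_schwarz _ _))// x0 expr0n !mulr0.
have := h _ (sn_normalize x0).
have r0 : 0 <= (sn x)^-1 by rewrite invr_ge0 sn_ge0.
have -> : f (S ((sn x)^-1%:C *: x)) ((sn x)^-1%:C *: x) =
    (sn x)^-1%:C * ((sn x)^-1%:C * f (S x) x).
  have -> : S ((sn x)^-1%:C *: x) = (sn x)^-1%:C *: S x by rewrite linearZ.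
  by rewrite linearZl_LR linearZr_LR /= conj_real.
rewrite !Re_normM !Re_norm_real//.
by rewrite mulrA -invfM mulrC -expr2 ler_pdivrMr// exprn_gt0// lt_def x0 sn_ge0.
Qed.

Lemma adjoint_opnorm (T : {linear V -> V}) (t : R) x z : 0 <= t ->
  (forall u, sn (T u) <= t * sn u) -> adjoint_at T x z -> sn z <= t * sn x.
Proof.
move=> t0 h hz; have [->|z0] := eqVneq (sn z) 0.
  by rewrite mulr_ge0 ?sn_ge0.
have zp : 0 < sn z by rewrite lt_def z0 sn_ge0.
rewrite -(ler_pM2l zp) -expr2 sqr_sn /re -hz -/(re (T z) x).
rewrite (le_trans (re_cauchy_schwarz _ _))// mulrCA mulrA ler_wpM2r ?sn_ge0//.
Qed.

(** Moving the outer operators to the other side leaves the pairings of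
    [S x] with [T# x] and of [T x] with [S# x]; the factor [sqrt 2] comes from
    [(a + b)^2 <= 2 (a^2 + b^2)]. *)
Lemma anticommutator_le (T S : {linear V -> V}) (t w : R) x :
  0 <= t -> 0 <= w -> adjointable T -> adjointable S ->
  (forall u, sn (T u) <= t * sn u) ->
  (forall u, complex.Re `|f (S u) u| <= w * re u u) ->
  sn x = 1 ->
  complex.Re `|f (T (S x) + S (T x)) x| <= 2 * Num.sqrt 2 * t * w.
Proof.
move=> t0 w0 /(_ x)[zT hT] /(_ x)[zS hS] bT bS x1.
have -> : f (T (S x) + S (T x)) x = f (S x) zT + f (T x) zS.
  by rewrite linearDl /= hT hS.
rewrite (le_trans (Re_normD _ _))//.
have := sqr_seminorm_op_adjoint bS w0 hS; rewrite x1 expr1n mulr1 => hab.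
have := bT x; have := adjoint_opnorm t0 bT hT; rewrite x1 mulr1 => hz hTx.
have h1 := cauchy_schwarz (S x) zT; have h2 := cauchy_schwarz (T x) zS.
have a0 := sn_ge0 (S x); have b0 := sn_ge0 zS.
set a := sn (S x) in hab h1 a0; set b := sn zS in hab h2 b0.
have h3 : a + b <= 2 * Num.sqrt 2 * w.
  rewrite -ler_sqr ?nnegrE ?mulr_ge0 ?addr_ge0 ?sqrtr_ge0//.
  by rewrite !exprMn sqr_sqrtr//; have := sqr_ge0 (a - b); lra.
apply: (le_trans (lerD h1 h2)).
have := ler_wpM2l t0 h3; have := ler_wpM2l a0 hz; have := ler_wpM2r b0 hTx.
lra.
Qed.

(** This takes care of the products [0 * +oo] of the two suprema. *)
Lemma anticommutator_null (T S : {linear V -> V}) x : adjointable S ->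
  (forall u, sn (T u) = 0) -> complex.Re `|f (T (S x) + S (T x)) x| <= 0.
Proof.
move=> /(_ x)[z hS] T0.
have -> : f (T (S x) + S (T x)) x = f (T (S x)) x + f (T x) z.
  by rewrite linearDl /= hS.
rewrite (le_trans (Re_normD _ _))//.
rewrite (le_trans (lerD (cauchy_schwarz _ _) (cauchy_schwarz _ _)))//.
by rewrite !T0 !mul0r addr0.
Qed.
End SemiInner.

(** Polarization: the values at [x + y] and at [x + 'i y] are real, which
    fixes the imaginary and the real part of [g x y - (g y x)^*]. *)
Lemma real_diag_hermitian (R : rcfType) (V : lmodType R[i])
    (g : {bilinear V -> V -> R[i] | *%R & (@Num.conj R[i] \; *%R)}) :
  (forall x, g x x \is Num.real) -> forall x y, g x y = Num.conj (g y x).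
Proof.
move=> gR x y.
have im0 z : complex.Im (g z z) = 0.
  by have := gR z; case: (g z z) => a b; rewrite complex_real => /eqP.
have e1 : g (x + y) (x + y) = g x x + g x y + (g y x + g y y).
  by rewrite linearDl !linearDr.
have e2 : g (x + 'i *: y) (x + 'i *: y) =
    g x x + Num.conj 'i * g x y + ('i * g y x + 'i * (Num.conj 'i * g y y)).
  by rewrite linearDl !linearDr !linearZl_LR !linearZr_LR.
have := im0 (x + y); have := im0 (x + 'i *: y); rewrite e1 e2.
move: (im0 x) (im0 y); rewrite conjCi -complexiE.
case: (g x x) (g x y) (g y x) (g y y) => a1 b1 [a2 b2] [a3 b3] [a4 b4] /= -> ->.
move=> h1 h2; apply/eqP; rewrite eq_complex /=.
by apply/andP; split; apply/eqP; lra.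
Qed.

(** * The form attached to a positive operator *)

Section Bridge.
Variables (R : realType) (H : completeNormedModType R[i]).
Variables (dot : {dot H for @Num.conj R[i]}) (A : {linear H -> H}).
Hypothesis HA : positive_operator dot A.

Lemma dotA_sesquilinear :
  bilinear_for ( *%R) (@Num.conj R[i] \; *%R) (dotA dot A : H -> H -> R[i]).
Proof.
split=> [y c x1 x2|x c y1 y2]; rewrite /dotA.
  have -> : A (c *: x1 + x2) = c *: A x1 + A x2 by rewrite linearD linearZ.
  by rewrite linearDl linearZl_LR.
by rewrite linearDr linearZr_LR.
Qed.

Definition dotA_bilinear :
    {bilinear H -> H -> R[i] | *%R & (@Num.conj R[i] \; *%R)} :=
  HB.pack (dotA dot A : H -> H -> R[i])
    (bilinear_isBilinear.Build _ _ _ _ _ _ _ dotA_sesquilinear).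

Lemma dotA_conjC x y :
  dotA dot A x y = (-1) ^+ false * Num.conj (dotA dot A y x).
Proof.
rewrite mul1r; apply: (@real_diag_hermitian _ _ dotA_bilinear) => z.
exact/ger0_real/HA.2.
Qed.

Definition dotA_hermitian : {hermitian H for false & @Num.conj R[i]} :=
  HB.pack (dotA dot A : H -> H -> R[i])
    (bilinear_isBilinear.Build _ _ _ _ _ _ _ dotA_sesquilinear)
   (isHermitianSesquilinear.Build _ _ _ _ _ dotA_conjC).

(** The range condition provides [z] with [A z = T^* A x], hence
    [<T y, x>_A = <y, T^* A x> = <y, A z> = <y, z>_A]. *)
Lemma in_BA_adjointable T : in_BA dot A T -> adjointable dotA_hermitian T.
Proof.
move=> [_ [Ts [_ hTs sub]]] x.
have [z _ Az] : range A (Ts (A x)) by apply: sub; exists x.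
exists z => y; rewrite [LHS]dotA_conjC [RHS]dotA_conjC /dotA Az.
rewrite -(hermC dot (T y) (A x)); exact: etrans (hTs y (A x)) (hermC dot y _).
Qed.
End Bridge.

(** * The inequality *)

Theorem theorem3p2 (R : realType) (H : completeNormedModType R[i])
    (dot : {dot H for @Num.conj R[i]}) (Hdot : norm_induced_by dot)
    (A : {linear H -> H}) (HA : positive_operator dot A)
    (T S : {linear H -> H}) (HT : in_BA dot A T) (HS : in_BA dot A S) :
  (numradiusA dot A ((T \o S) \+ (S \o T))%R <=
     (2 * Num.sqrt 2)%R%:E * opnormA dot A T * numradiusA dot A S)%E.
Proof.
have aT := in_BA_adjointable HA HT; have aS := in_BA_adjointable HA HS.
have fge0 : forall x, 0 <= dotA_hermitian HA x x by move=> x; exact: HA.2.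
apply: ge_ereal_sup => _ [x x1 <-].
have ubT u : seminormA dot A u = 1 ->
    ((seminormA dot A (T u))%:E <= opnormA dot A T)%E.
  by move=> u1; apply: ereal_sup_ubound; exists u.
have ubS u : seminormA dot A u = 1 ->
    ((complex.Re `|dotA dot A (S u) u|)%:E <= numradiusA dot A S)%E.
  by move=> u1; apply: ereal_sup_ubound; exists u.
have t0 : (0 <= opnormA dot A T)%E.
  by apply: le_trans (ubT _ x1); rewrite lee_fin sqrtr_ge0.
have w0 : (0 <= numradiusA dot A S)%E.
  apply: le_trans (ubS _ x1); rewrite lee_fin.
  by have := normr_ge0 (dotA dot A (S x) x); rewrite lecE => /andP[].
have c0 : 0 < 2 * Num.sqrt 2 :> R by rewrite mulr_gt0 ?sqrtr_gt0.
(* A zero supremum makes the operator null on all vectors, not only on unit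
   ones, so the left-hand side is zero even if the other supremum is [+oo]. *)
have nullT : opnormA dot A T = 0%E ->
    complex.Re `|dotA dot A (T (S x) + S (T x)) x| <= 0.
  move=> T0; apply: (@anticommutator_null _ _ (dotA_hermitian HA)) => // u.
  apply/eqP; rewrite eq_le sqrtr_ge0 andbT -(mul0r (seminormA dot A u)).
  apply: (@opnorm_homogeneous _ _ (dotA_hermitian HA)) => // v /ubT.
  by rewrite T0 lee_fin.
have nullS : numradiusA dot A S = 0%E ->
    complex.Re `|dotA dot A (T (S x) + S (T x)) x| <= 0.
  move=> S0; rewrite addrC.
  apply: (@anticommutator_null _ _ (dotA_hermitian HA)) => // u.
  have bS v : complex.Re `|dotA_hermitian HA (S v) v| <=
      0 * complex.Re (dotA_hermitian HA v v).
    apply: (@numradius_homogeneous _ _ (dotA_hermitian HA)) => // {}v /ubS.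
    by rewrite S0 lee_fin.
  have [z hz] := aS u.
  have := sqr_seminorm_op_adjoint fge0 bS (lexx 0) hz.
  rewrite expr0n /= mulr0 mul0r.
  set p := Num.sqrt _; set q := Num.sqrt _ => pq.
  apply/eqP; rewrite -sqrf_eq0 eq_le sqr_ge0 andbT; have := sqr_ge0 q; lra.
have fin t w : opnormA dot A T = t%:E -> numradiusA dot A S = w%:E ->
    complex.Re `|dotA dot A (T (S x) + S (T x)) x| <= 2 * Num.sqrt 2 * t * w.
  move=> tE wE; rewrite tE wE !lee_fin in t0 w0.
  apply: (@anticommutator_le _ _ (dotA_hermitian HA)) => //.
    apply: opnorm_homogeneous => // u /ubT; by rewrite tE lee_fin.
  apply: numradius_homogeneous => // u /ubS; by rewrite wE lee_fin.
case: (opnormA dot A T) t0 nullT fin => [t| |] // t0 nT fin.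
  case: (numradiusA dot A S) w0 nullS fin => [w| |] // w0 nS fin.
    by rewrite -!EFinM lee_fin; exact: fin.
  rewrite le_eqVlt in t0; case/orP: t0 => [/eqP t0|t0].
    by rewrite -t0 mule0 mul0e lee_fin; apply: nT.
  by rewrite gt0_muley ?mule_gt0 ?lte_fin// leey.
rewrite le_eqVlt in w0; case/orP: w0 => [/eqP w0|w0].
  by rewrite -w0 mule0 lee_fin; apply: nullS.
by rewrite gt0_muley ?lte_fin// gt0_mulye// leey.
Qed.
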